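(* Let $\mathbf{A}\in\mathbb{KR}^{n\times n}$ and $\mathbf{b}\in\mathbb{KR}^n$. Let the point matrix $G\in\mathbb{R}^{n\times n}$ and the interval matrix $\mathbf{H}\in\mathbb{KR}^{n\times n}$ be the result of applying to $\mathbf{A}$ either Splitting (I) or Splitting (II) described in the context, with $G^{\sim}$ nonsingular, and let $\mathcal{V}=(G^{\sim})^{-1}\in\mathbb{R}^{2n\times 2n}$. If the spectral radius satisfies $$\rho\bigl(|\mathcal{V}|\,|\mathbf{H}|^{\sim}\bigr)<1,$$ then a formal solution $\mathbf{x}^\ast\in\mathbb{KR}^n$ of the interval linear system $\mathbf{A}x=\mathbf{b}$ exists and is unique, and, for any initial approximation $x^{(0)}\in\mathbb{R}^{2n}$, the iterations $$x^{(k+1)}=(G^{\sim})^{-1}\,\mathrm{sti}\bigl(\mathbf{b}\ominus\mathbf{H}\,\mathrm{sti}^{-1}(x^{(k)})\bigr),\qquad k=0,1,2,\dots,$$ in the case of Splitting (I), respectively $$x^{(k+1)}=(G^{\sim})^{-1}\,\mathrm{sti}\bigl(\mathbf{b}\ominus\mathcal{H}(\mathrm{sti}^{-1}(x^{(k)}))\bigr),\qquad k=0,1,2,\dots,$$ in the case of Splitting (II), converge in $\mathbb{R}^{2n}$ to $\mathrm{sti}(\mathbf{x}^\ast)$.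
   Context: Kaucher interval arithmetic. $\mathbb{KR}$ is the set of all pairs $\mathbf{a}=[\underline{\mathbf{a}},\overline{\mathbf{a}}]$ of real numbers (no order relation between the endpoints is required); $\mathbf{a}$ is proper if $\underline{\mathbf{a}}\le\overline{\mathbf{a}}$ and improper otherwise. A real number $a$ is identified with $[a,a]$. For a real $a$ put $a^+=\max\{a,0\}$, $a^-=\max\{-a,0\}$. Operations: - $\mathbf{a}+\mathbf{b}=[\underline{\mathbf{a}}+\underline{\mathbf{b}},\overline{\mathbf{a}}+\overline{\mathbf{b}}]$; $\mathbf{a}-\mathbf{b}=[\underline{\mathbf{a}}-\overline{\mathbf{b}},\overline{\mathbf{a}}-\underline{\mathbf{b}}]$; $\mathbf{a}\ominus\mathbf{b}=[\underline{\mathbf{a}}-\underline{\mathbf{b}},\overline{\mathbf{a}}-\overline{\mathbf{b}}]$ (inverse operation to addition); - $\mathbf{a}\cdot\mathbf{b}=\bigl[\max\{\underline{\mathbf{a}}^+\underline{\mathbf{b}}^+,\overline{\mathbf{a}}^-\overline{\mathbf{b}}^-\}-\max\{\overline{\mathbf{a}}^+\underline{\mathbf{b}}^-,\underline{\mathbf{a}}^-\overline{\mathbf{b}}^+\},\ \max\{\overline{\mathbf{a}}^+\overline{\mathbf{b}}^+,\underline{\mathbf{a}}^-\underline{\mathbf{b}}^-\}-\max\{\underline{\mathbf{a}}^+\overline{\mathbf{b}}^-,\overline{\mathbf{a}}^-\underline{\mathbf{b}}^+\}\bigr]$; - $\mathrm{dual}\,\mathbf{a}=[\overline{\mathbf{a}},\underline{\mathbf{a}}]$;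 $\mathrm{pro}\,\mathbf{a}=\mathbf{a}$ if $\mathbf{a}$ is proper and $\mathrm{dual}\,\mathbf{a}$ otherwise (regarded as a set of reals); $|\mathbf{a}|=\max\{|\underline{\mathbf{a}}|,|\overline{\mathbf{a}}|\}$. $\mathbf{a}>0$ (resp. $\mathbf{a}<0$) means both endpoints are positive (resp. negative). Operations on interval vectors and matrices are componentwise, with $(\mathbf{A}\mathbf{x})_i=\sum_{j}\mathbf{a}_{ij}\mathbf{x}_j$, and $|\cdot|$ is applied entrywise to (interval or point) matrices. A formal solution of $\mathbf{A}x=\mathbf{b}$ is an interval vector $\mathbf{x}\in\mathbb{KR}^n$ such that $\mathbf{A}\mathbf{x}=\mathbf{b}$ holds as an equality in Kaucher arithmetic. Standard immersion: $\mathrm{sti}:\mathbb{KR}^n\to\mathbb{R}^{2n}$, $\mathrm{sti}(\mathbf{x}_1,\dots,\mathbf{x}_n)=(-\underline{\mathbf{x}}_1,\dots,-\underline{\mathbf{x}}_n,\overline{\mathbf{x}}_1,\dots,\overline{\mathbf{x}}_n)$; it is a bijection. Extended multiplier matrix: for a real $n\times n$ matrix $Q=(q_{ij})$, $Q^{\sim}=\begin{pmatrix}Q^+&Q^-\\Q^-&Q^+\end{pmatrix}\in\mathbb{R}^{2n\times2n}$, where $Q^{+}=(q_{ij}^{+})$, $Q^-=(q_{ij}^-)$. Here $|\mathbf{H}|^{\sim}$ is the extended multiplier matrix of the real matrix $|\mathbf{H}|$. Splitting (I). For $\mathbf{a}\in\mathbb{KR}$ let $\lfloor\mathbf{a}\rfloor=\max\{\underline{\mathbf{a}},\overline{\mathbf{a}}\}$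 if $\mathbf{a}<0$, $\lfloor\mathbf{a}\rfloor=0$ if $0\in\mathrm{pro}\,\mathbf{a}$, and $\lfloor\mathbf{a}\rfloor=\min\{\underline{\mathbf{a}},\overline{\mathbf{a}}\}$ if $\mathbf{a}>0$. $G=(g_{ij})$ is any real $n\times n$ matrix such that each $g_{ij}$ lies between $0$ and $\lfloor\mathbf{a}_{ij}\rfloor$ (inclusive), and $\mathbf{H}=\mathbf{A}-G$. Splitting (II). For $\mathbf{a}\in\mathbb{KR}$ let $\lceil\mathbf{a}\rceil=0$ if $0\in\mathrm{pro}\,\mathbf{a}$, $\lceil\mathbf{a}\rceil=\min\{\underline{\mathbf{a}},\overline{\mathbf{a}}\}$ if $\mathbf{a}<0$, and $\lceil\mathbf{a}\rceil=\max\{\underline{\mathbf{a}},\overline{\mathbf{a}}\}$ if $\mathbf{a}>0$. $G=(g_{ij})$ with $g_{ij}=\lceil\mathbf{a}_{ij}\rceil$, $\mathbf{H}=(\mathbf{h}_{ij})=\mathbf{A}-G$, and $\mathcal{H}:\mathbb{KR}^n\to\mathbb{KR}^n$ is defined by $\mathcal{H}_i(\mathbf{x})=\sum_{j=1}^n\mathbf{h}_{ij}\cdot\mathbf{y}_{ij}$, where $\mathbf{y}_{ij}=\mathbf{x}_j$ if $g_{ij}=0$ and $\mathbf{y}_{ij}=\mathrm{dual}\,\mathbf{x}_j$ otherwise. *)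

(* Defs.v *)
From HB Require Import structures.
From mathcomp Require Import all_boot all_order all_algebra.
From mathcomp Require Import complex.
From mathcomp Require Import all_classical all_reals all_analysis.
From mathcomp Require Import lra.

Set Implicit Arguments.
Unset Strict Implicit.
Unset Printing Implicit Defensive.

Import Order.TTheory GRing.Theory Num.Theory.

Local Open Scope classical_set_scope.
Local Open Scope ring_scope.

Section KaucherArithmetic.
Variable R : realType.
Implicit Type r : R.

(* A dedicated record rather than [R * R]: the product ring structure of
   [R * R] has a multiplication that is not Kaucher's. *)
Record KR := MkKR { klo : R; khi : R }.
Implicit Types a b : KR.

Definition kpoint r : KR := MkKR r r.

Definition rpos r : R := Num.max r 0.
Definition rneg r : R := Num.max (- r) 0.

Definition kadd a b : KR := MkKR (klo a + klo b) (khi a + khi b).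
Definition ksub a b : KR := MkKR (klo a - khi b) (khi a - klo b).
(* the inverse operation to [kadd], unlike [ksub] *)
Definition kominus a b : KR := MkKR (klo a - klo b) (khi a - khi b).
Definition kmul a b : KR :=
  MkKR
    (Num.max (rpos (klo a) * rpos (klo b)) (rneg (khi a) * rneg (khi b))
     - Num.max (rpos (khi a) * rneg (klo b)) (rneg (klo a) * rpos (khi b)))
    (Num.max (rpos (khi a) * rpos (khi b)) (rneg (klo a) * rneg (klo b))
     - Num.max (rpos (klo a) * rneg (khi b)) (rneg (khi a) * rpos (klo b))).

Definition kproper a : bool := klo a <= khi a.
Definition kdual a : KR := MkKR (khi a) (klo a).
Definition kpro a : KR := if kproper a then a else kdual a.
Definition mem_pro r a : bool := klo (kpro a) <= r <= khi (kpro a).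
Definition kabs a : R := Num.max `|klo a| `|khi a|.
Definition kpos a : bool := (0 < klo a) && (0 < khi a).
Definition kneg a : bool := (klo a < 0) && (khi a < 0).

Definition kfloor a : R :=
  if kneg a then Num.max (klo a) (khi a)
  else if kpos a then Num.min (klo a) (khi a)
  else 0.

Definition kceil a : R :=
  if kneg a then Num.min (klo a) (khi a)
  else if kpos a then Num.max (klo a) (khi a)
  else 0.

(* The last branch of [kfloor] and [kceil] is exactly the case 0 \in pro a. *)
Lemma mem_pro0E a : mem_pro 0 a = ~~ kneg a && ~~ kpos a.
Proof.
rewrite /mem_pro /kpro /kproper /kneg /kpos.
case: a => l h /=; case: (leP l h) => lh /=;
  by case: (ltgtP l 0); case: (ltgtP h 0) => //= *; lra.
Qed.

Lemma kaddA : associative kadd.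
Proof. by move=> a b c; congr MkKR; rewrite /= addrA. Qed.
Lemma kaddC : commutative kadd.
Proof. by move=> a b; congr MkKR; rewrite /= addrC. Qed.
Lemma kadd0 : left_id (kpoint 0) kadd.
Proof. by case=> l h; rewrite /kadd /= !add0r. Qed.

HB.instance Definition _ :=
  Monoid.isComLaw.Build KR (kpoint 0) kadd kaddA kaddC kadd0.

Variable n : nat.
Implicit Types (A H : 'M[KR]_n) (G Q : 'M[R]_n) (x c : 'cV[KR]_n).

Definition ksum (I : finType) (F : I -> KR) : KR :=
  \big[kadd/kpoint 0]_(i : I) F i.

Definition kmulmx A x : 'cV[KR]_n :=
  \col_i ksum (fun j => kmul (A i j) (x j 0)).

Definition kvominus c x : 'cV[KR]_n := \col_i kominus (c i 0) (x i 0).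

Definition ksubmx A G : 'M[KR]_n := \matrix_(i, j) ksub (A i j) (kpoint (G i j)).

Definition kabsmx H : 'M[R]_n := map_mx kabs H.

Definition formal_solution A c x : Prop := kmulmx A x = c.

Definition sti x : 'cV[R]_(n + n) :=
  col_mx (\col_i - klo (x i 0)) (\col_i khi (x i 0)).

Definition sti_inv (y : 'cV[R]_(n + n)) : 'cV[KR]_n :=
  \col_i MkKR (- usubmx y i 0) (dsubmx y i 0).

Lemma stiK : cancel sti sti_inv.
Proof.
move=> x; apply/colP => i.
by rewrite mxE /sti col_mxKu col_mxKd !mxE opprK; case: (x i 0).
Qed.

Lemma sti_invK : cancel sti_inv sti.
Proof.
move=> y; rewrite -[RHS]vsubmxK /sti.
by congr col_mx; apply/colP => i; rewrite !mxE /= ?opprK.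
Qed.

Definition extmul Q : 'M[R]_(n + n) :=
  block_mx (map_mx rpos Q) (map_mx rneg Q) (map_mx rneg Q) (map_mx rpos Q).

(* "g lies between 0 and f" does not presuppose a sign of f. *)
Definition splittingI A G H : Prop :=
  (forall i j, Num.min 0 (kfloor (A i j)) <= G i j
                 <= Num.max 0 (kfloor (A i j)))
  /\ H = ksubmx A G.

Definition splittingII A G H : Prop :=
  G = map_mx kceil A /\ H = ksubmx A G.

Definition kop G H x : 'cV[KR]_n :=
  \col_i ksum (fun j =>
    kmul (H i j) (if G i j == 0 then x j 0 else kdual (x j 0))).

Definition stepI G H c (y : 'cV[R]_(n + n)) : 'cV[R]_(n + n) :=
  invmx (extmul G) *m sti (kvominus c (kmulmx H (sti_inv y))).

Definition stepII G H c (y : 'cV[R]_(n + n)) : 'cV[R]_(n + n) :=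
  invmx (extmul G) *m sti (kvominus c (kop G H (sti_inv y))).

End KaucherArithmetic.

(* entrywise, as opposed to `|M|, the max norm of M *)
Definition absmx (R : realType) (m p : nat) (M : 'M[R]_(m, p)) : 'M[R]_(m, p) :=
  map_mx (fun r => `|r|) M.

(* The eigenvalues are taken in R[i]; for m = 0 the set is empty and its
   [sup] is 0. *)
Definition spectral_radius (R : realType) (m : nat) (M : 'M[R]_m) : R :=
  sup [set ComplexField.Normc.normc l |
        l in [set l : R[i] | eigenvalue (map_mx (real_complex R) M) l]].

(* Main.v *)
From HB Require Import structures.
Require Import Defs.
From mathcomp Require Import all_boot all_order all_algebra.
From mathcomp Require Import complex.
From mathcomp Require Import all_classical all_reals all_analysis.
From mathcomp Require Import ring lra.
Import Order.TTheory GRing.Theory Num.Theory.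
Import numFieldNormedType.Exports.
(* brings the interval [kadd] back in front of the sum of kernels *)
Import Defs.

Local Open Scope classical_set_scope.
Local Open Scope ring_scope.

Set Implicit Arguments.
Unset Strict Implicit.
Unset Printing Implicit Defensive.

(** Write each iteration as x |-> V sti(b - Phi(sti^-1 x)), where V is the
    inverse of G~ and Phi is x |-> H x or its variant with duals.

    A fixed point is the immersion of a formal solution. The matrix G~ acts on
    immersed vectors as the point matrix G acts on interval vectors
    ([extmul_sti]), so a fixed point solves G x + Phi x = b, and both
    splittings are designed so that A x = G x + Phi x, although Kaucher
    multiplication is not distributive in general. The reason is that on
    multipliers with both endpoints nonnegative, multiplication by x is the
    additive map [kscale _ x], and on multipliers with both endpoints
    nonpositive it is [kscale _ (kdual x)]. In Splitting (I) the point g and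
    the remainder a - g lie in the same one of these two orthants; in
    Splitting (II) they lie in opposite ones, and replacing x by its dual in
    the second product compensates for that ([kmul_splitI], [kmul_splitII]).

    The iteration is a contraction. Multiplication by h is Lipschitz with
    constant |h| for the distance max(|lower|, |upper|) between intervals
    ([kdist_kmul_le]). It is not Lipschitz endpoint by endpoint: multiplying by
    [-1, 1] or by -1 mixes the endpoints, so the difference of two iterates
    need not be bounded entrywise by |V| |H|~ times the previous one. What saves
    the estimate is symmetry: |V| and |H|~ commute with the exchange of the two
    halves of R^2n. Hence a positive vector u with |V| |H|~ u < u can be
    averaged with its exchanged copy into one of the form (w, w)
    ([symmetric_weight]); for the maximum norm weighted by (w, w) the endpoints
    of an interval carry equal weights, and the bound by the larger endpoint
    difference suffices.

    The positive vector comes from the spectral radius by a continuity argument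
    that uses only real eigenvalues ([spectral_radius_lt1_weight]), and the
    theorem is then the contraction principle in the weighted norm
    ([weighted_contraction_fixed_point]). *)

(** * Nonnegative matrices of spectral radius less than one *)

(** The spectral radius is a supremum over the complex eigenvalues; these are
    finitely many, and that is what makes it an upper bound. *)
Lemma eigenvalue_le_spectral_radius (R : realType) m (M : 'M[R]_m) (l : R) :
  eigenvalue M l -> `|l| <= spectral_radius M.
Proof.
move=> Ml; apply: ub_le_sup; last first.
  exists (real_complex R l); last by rewrite /= expr0n addr0 sqrtr_sqr.
  by rewrite /= eigenvalue_root_char -map_char_poly fmorph_root
     -eigenvalue_root_char.
set p := char_poly (map_mx (real_complex R) M).
have [r pE] := closed_field_poly_normal p.
exists (\sum_(z <- r) ComplexField.Normc.normc z) => _ [z + <-].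
rewrite /= eigenvalue_root_char -/p pE rootZ ?lead_coef_eq0; last first.
  by rewrite monic_neq0 ?char_poly_monic.
rewrite root_prod_XsubC => zr; rewrite (big_rem z)//= lerDl.
by apply: sumr_ge0 => w _; case: w => x y; exact: sqrtr_ge0.
Qed.

Section PositiveResolvent.
Variables (R : realType) (m : nat) (M : 'M[R]_m).
Hypothesis M_ge0 : forall i j, 0 <= M i j.
Hypothesis M_det : forall s : R, 0 <= s <= 1 -> \det (1%:M - s *: M) != 0.

(* The determinant and the adjugate of 1 - s M are polynomials in s, the
   entries of those of [pencil]; their continuity in s comes from there. *)
Let pencil : 'M[{poly R}]_m := 1%:M - 'X *: map_mx polyC M.
Let one : 'cV[R]_m := const_mx 1.
(* (1 - s M)^-1 applied to the all-ones vector, by Cramer's rule *)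
Let resolvent s : 'cV[R]_m :=
  (\det (1%:M - s *: M))^-1 *: (\adj (1%:M - s *: M) *m one).

Let pencilE (s : R) : map_mx (horner_eval s) pencil = 1%:M - s *: M.
Proof.
apply/matrixP => i j; rewrite !mxE /horner_eval !hornerE.
by case: eqP => _; rewrite ?mulr1n ?mulr0n ?hornerE.
Qed.

Let resolvent_eq (s : R) : 0 <= s <= 1 ->
  resolvent s = one + s *: (M *m resolvent s).
Proof.
move=> s01; apply/eqP; rewrite -subr_eq; apply/eqP.
rewrite scalemxAl -{1}[resolvent s]mul1mx -mulmxBl /resolvent.
rewrite -scalemxAr mulmxA mul_mx_adj mul_scalar_mx scalerA mulVf ?M_det//.
by rewrite scale1r.
Qed.

Let resolvent_continuous i (s : R) : 0 <= s <= 1 ->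
  {for s, continuous (fun t => resolvent t i 0)}.
Proof.
pose num : {poly R} := (\adj pencil *m (const_mx 1 : 'cV_m)) i 0.
have numE t : num.[t] = (\adj (1%:M - t *: M) *m one) i 0.
  rewrite -pencilE -map_mx_adj -[one](_ : map_mx (horner_eval t) (const_mx 1) = _).
    by rewrite -map_mxM [RHS]mxE.
  by apply/matrixP => k j; rewrite !mxE /horner_eval hornerE.
have denE t : (\det pencil).[t] = \det (1%:M - t *: M).
  by rewrite -pencilE det_map_mx.
have -> : (fun t => resolvent t i 0) = (fun t => (\det pencil).[t]^-1 * num.[t]).
  by apply/funext => t; rewrite numE denE /resolvent mxE.
move=> s01; apply: (@cvgM R R); last exact: continuous_horner.
by apply: cvgV; [rewrite denE M_det|exact: continuous_horner].
Qed.

(** Follow u(s) = (1 - s M)^-1 1 from s = 0 to s = 1. Since u = 1 + s M u, a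
    nonnegative u(s) has all its entries at least 1, so the minimum of 1 and
    the entries of u(s) is a continuous function of s that takes no value in
    [0, 1); as it starts at 1, it never becomes negative. *)
Lemma positive_resolvent : exists2 u : 'cV[R]_m,
  (forall i, 1 <= u i 0) & M *m u = u - const_mx 1.
Proof.
have ge1 (s : R) : 0 <= s <= 1 -> (forall i, 0 <= resolvent s i 0) ->
    forall i, 1 <= resolvent s i 0.
  move=> s01 us i; rewrite resolvent_eq// !mxE lerDl.
  rewrite mulr_ge0//; first by case/andP: s01.
  by apply: sumr_ge0 => j _; rewrite mulr_ge0.
pose f s : R := \big[Num.min/1]_i resolvent s i 0.
have f_le s i : f s <= resolvent s i 0 by exact: bigmin_le_cond.
have f_gap (s : R) : 0 <= s <= 1 -> 0 <= f s -> f s = 1.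
  move=> s01 fs0; apply/eqP; rewrite eq_le bigmin_le_id/=.
  apply/bigmin_geP; split => // i _; apply: ge1 => // j.
  exact: le_trans (f_le s j).
have f_cont : {within `[0, 1], continuous f}.
  apply: continuous_in_subspaceT => s; rewrite inE/= in_itv/= => s01.
  have -> : f = (\big[(fun g h => g \min h)/cst 1]_i (fun s => resolvent s i 0)).
    by apply/funext => t; rewrite /f; elim/big_ind2: _ => // x g y h -> ->.
  elim/big_ind: _ => [|g h gc hc|i _]; first exact: cvg_cst.
    exact: continuous_min.
  exact: resolvent_continuous.
have f0 : f 0 = 1.
  apply: f_gap; first by rewrite lexx ler01.
  apply/bigmin_geP; split => // i _.
  by rewrite resolvent_eq ?lexx ?ler01// scale0r addr0 mxE.
have f1 : 0 <= f 1.
  rewrite leNgt; apply/negP => f1.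
  have [|s /f_gap + fs0] := @IVT R f 0 1 0 ler01 f_cont.
    by rewrite f0 ge_min (ltW f1) orbT le_max ler01.
  by rewrite fs0 => /(_ (lexx 0))/eqP; rewrite eq_sym oner_eq0.
have e11 : 0 <= (1 : R) <= 1 by rewrite ler01 lexx.
exists (resolvent 1).
  by apply: ge1 => // i; exact: le_trans (f_le 1 i).
by rewrite {2}resolvent_eq// scale1r addrC addKr.
Qed.
End PositiveResolvent.

(** A zero of det(1 - s M) with 0 < s <= 1 would give the eigenvalue
    1/s >= 1. *)
Lemma spectral_radius_lt1_weight (R : realType) m (M : 'M[R]_m) :
    (forall i j, 0 <= M i j) -> spectral_radius M < 1 ->
  exists2 u : 'cV[R]_m, (forall i, 0 < u i 0) &
    forall i, (M *m u) i 0 < u i 0.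
Proof.
move=> M0 rM; have [] := @positive_resolvent R m M M0.
  move=> s /andP[s0 s1]; apply/negP => /det0P[v v0].
  rewrite mulmxBr mulmx1 -scalemxAr => /subr0_eq vE.
  have s_neq0 : s != 0.
    by apply: contra_neq v0 => se0; rewrite vE se0 scale0r.
  have : eigenvalue M s^-1.
    by apply/eigenvalueP; exists v => //; rewrite {2}vE scalerA mulVf// scale1r.
  move/eigenvalue_le_spectral_radius; rewrite leNgt => /negP; apply.
  apply: (lt_le_trans rM); rewrite ger0_norm ?invr_ge0//.
  by rewrite invf_ge1// lt0r s_neq0.
move=> u u1 Mu; exists u => i; first exact: lt_le_trans (u1 i).
by rewrite Mu !mxE gtrBl.
Qed.

(** * Contractions in a weighted maximum norm *)

(* [banach_fixed_point] needs the join of the complete and the normed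
   structures on column vectors. *)
HB.instance Definition _ (R : realType) m n := Complete.on 'M[R]_(m, n).

Lemma norm_col_leP (R : realType) m (v : 'cV[R]_m) c : 0 <= c ->
  reflect (forall i, `|v i 0| <= c) (`|v| <= c).
Proof.
move=> c0; rewrite [`|v|](mx_normrE v); apply: (iffP idP) => [|vc].
  by move=> /bigmax_leP[_ vc] i; exact: (vc (i, 0)).
by apply/bigmax_leP; split => // -[i j] _ /=; rewrite ord1.
Qed.

Lemma norm_col_entry (R : realType) m (v : 'cV[R]_m) i : `|v i 0| <= `|v|.
Proof. by move: i; apply/norm_col_leP. Qed.

(** Rescaling the coordinates by the weights u turns the weighted norm into the
    ordinary maximum norm, where Banach's theorem applies; all norms involved
    being equivalent, the iterates converge in the original coordinates. *)
Lemma weighted_contraction_fixed_point (R : realType) m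
    (F : 'cV[R]_m -> 'cV[R]_m) (u : 'cV[R]_m) (q : R) :
    (forall i, 0 < u i 0) -> 0 <= q < 1 ->
    (forall (y z : 'cV[R]_m) c, (forall i, `|y i 0 - z i 0| <= c * u i 0) ->
       forall i, `|F y i 0 - F z i 0| <= q * c * u i 0) ->
  exists p, [/\ F p = p, forall p', F p' = p' -> p' = p &
    forall x : nat -> 'cV[R]_m, (forall k, x k.+1 = F (x k)) -> x @ \oo --> p].
Proof.
move=> u0 /andP[q0 q1] FL.
(* In the rescaled coordinates z = E y the map F becomes E \o F \o D. *)
pose D (z : 'cV[R]_m) : 'cV[R]_m := \col_i (u i 0 * z i 0).
pose E (z : 'cV[R]_m) : 'cV[R]_m := \col_i ((u i 0)^-1 * z i 0).
have DK : cancel D E by move=> z; apply/colP => i; rewrite !mxE mulKf ?gt_eqF.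
have EK : cancel E D by move=> z; apply/colP => i; rewrite !mxE mulVKf ?gt_eqF.
have FD y z : `|E (F (D y)) - E (F (D z))| <= q * `|y - z|.
  have h i : `|D y i 0 - D z i 0| <= `|y - z| * u i 0.
    rewrite !mxE -mulrBr normrM gtr0_norm// mulrC ler_wpM2r ?(ltW (u0 i))//.
    by have := norm_col_entry (y - z) i; rewrite !mxE.
  apply/(norm_col_leP _ (mulr_ge0 q0 (normr_ge0 _))) => i.
  rewrite !mxE -mulrBr normrM gtr0_norm ?invr_gt0// mulrC ler_pdivrMr//.
  exact: FL.
have FDset : set_fun setT setT (E \o F \o D) by [].
pose Phi : {fun [set: 'cV[R]_m] >-> [set: 'cV[R]_m]} := mkfun_fun FDset.
have Phi_contr : is_contraction Phi.
  by exists (NngNum q0); split => // -[y z] _; exact: FD.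
have [p0 _ p0E] :=
  @banach_fixed_point R 'cV[R]_m setT Phi Phi_contr closedT (ex_intro _ 0 I).
have pE : F (D p0) = D p0 by rewrite {2}p0E /= /mkfun /= EK.
have p_uniq p' : F p' = p' -> p' = D p0.
  move=> p'E; rewrite -[p']EK; congr D.
  apply: (contraction_fixpoint_unique Phi_contr) => //=.
  by rewrite /mkfun /= EK p'E.
exists (D p0); split => // x xS.
have xq k : `|E (x k) - p0| <= `|E (x 0) - p0| * q ^+ k.
  elim: k => [|k IH]; first by rewrite expr0 mulr1.
  rewrite xS -[x k]EK -[in leLHS](DK p0) -pE.
  by apply: (le_trans (FD _ _)); rewrite exprS mulrCA ler_wpM2l.
have xu k : `|x k - D p0| <= `|u| * `|E (x 0) - p0| * q ^+ k.
  rewrite -mulrA; apply: le_trans (ler_wpM2l (normr_ge0 _) (xq k)).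
  apply/(norm_col_leP _ (mulr_ge0 (normr_ge0 _) (normr_ge0 _))) => i.
  have -> : (x k - D p0) i 0 = u i 0 * (E (x k) - p0) i 0.
    by rewrite -[x k]EK DK !mxE mulrBr.
  by rewrite normrM ler_pM// norm_col_entry.
have x_dist0 : (fun k => `|x k - D p0|) @ \oo --> (0 : R).
  apply: (@squeeze_cvgr _ _ _ _ (cst 0) (geometric (`|u| * `|E (x 0) - p0|) q)).
  - by apply: nearW => k; rewrite /= normr_ge0 xu.
  - exact: cvg_cst.
  - by apply: cvg_geometric; rewrite ger0_norm.
have /subr_cvg0 // : (fun k => x k - D p0) @ \oo --> (0 : 'cV[R]_m).
exact: norm_cvg0.
Qed.

(** * Kaucher multiplication *)

Section KaucherScalar.
Variable R : realType.
Implicit Types (r s t p q K : R) (a b x y : KR R).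

Lemma rposBrneg r : rpos r - rneg r = r.
Proof.
by rewrite /rpos /rneg; case: (leP r 0) => r0; rewrite maxEle; case: ifP; lra.
Qed.

Lemma rpos_id r : 0 <= r -> rpos r = r.
Proof. by move=> r0; apply/max_idPl. Qed.
Lemma rneg_id r : r <= 0 -> rneg r = - r.
Proof. by move=> r0; apply/max_idPl; rewrite oppr_ge0. Qed.
Lemma rpos_eq0 r : r <= 0 -> rpos r = 0.
Proof. by move=> r0; apply/max_idPr. Qed.
Lemma rneg_eq0 r : 0 <= r -> rneg r = 0.
Proof. by move=> r0; apply/max_idPr; rewrite oppr_le0. Qed.
Lemma rpos_ge0 r : 0 <= rpos r.
Proof. by rewrite le_max lexx orbT. Qed.
Lemma rneg_ge0 r : 0 <= rneg r.
Proof. by rewrite le_max lexx orbT. Qed.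

(** Multiplication by a nonnegative a, prolonged to all a by the same formula,
    which is linear in the endpoints of a. *)
Definition kscale a x : KR R :=
  MkKR (klo a * rpos (klo x) - khi a * rneg (klo x))
       (khi a * rpos (khi x) - klo a * rneg (khi x)).

Lemma kscaleD a b x : kscale (kadd a b) x = kadd (kscale a x) (kscale b x).
Proof. by congr MkKR => /=; ring. Qed.

Lemma kmul_ge0 a x : 0 <= klo a -> 0 <= khi a -> kmul a x = kscale a x.
Proof.
case: a x => [al ah] [xl xh] /= al0 ah0; rewrite /kmul /kscale /=.
rewrite !(rpos_id al0, rpos_id ah0, rneg_eq0 al0, rneg_eq0 ah0) !mul0r.
by rewrite !(max_idPl _) ?mulr_ge0 ?rpos_ge0 ?rneg_ge0.
Qed.

Lemma kmul_le0 a x : klo a <= 0 -> khi a <= 0 -> kmul a x = kscale a (kdual x).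
Proof.
case: a x => [al ah] [xl xh] /= al0 ah0; rewrite /kmul /kscale /=.
rewrite !(rpos_eq0 al0, rpos_eq0 ah0, rneg_id al0, rneg_id ah0) !mul0r.
rewrite !(max_idPr _) ?mulr_ge0 ?oppr_ge0 ?rpos_ge0 ?rneg_ge0//.
by congr MkKR; ring.
Qed.

Lemma kmul_point r x : kmul (kpoint r) x =
  MkKR (rpos r * klo x - rneg r * khi x) (rpos r * khi x - rneg r * klo x).
Proof.
have [r0|/ltW r0] := leP 0 r.
  rewrite kmul_ge0// /kscale /= -!mulrBr !rposBrneg rpos_id// rneg_eq0//.
  by rewrite !mul0r !subr0.
rewrite kmul_le0// /kscale /= -!mulrBr !rposBrneg rpos_eq0// rneg_id//.
by rewrite !mul0r !sub0r !mulNr !opprK.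
Qed.

(** The two endpoint differences are merged into their maximum because the
    multiplication mixes the endpoints. *)
Definition kdist x y : R := Num.max `|klo x - klo y| `|khi x - khi y|.

Lemma kdist_dual x y : kdist (kdual x) (kdual y) = kdist x y.
Proof. exact: maxC. Qed.

Lemma norm_maxB_le r s t p q :
  `|r - t| <= q -> `|s - p| <= q -> `|Num.max r s - Num.max t p| <= q.
Proof.
rewrite !ler_norml => /andP[? ?] /andP[? ?].
by case: (leP r s); case: (leP t p) => ? ?; lra.
Qed.

Lemma norm_rposB_le r s : `|rpos r - rpos s| <= `|r - s|.
Proof. by apply: norm_maxB_le; rewrite ?lexx// subrr normr0. Qed.

Lemma norm_rnegB_le r s : `|rneg r - rneg s| <= `|r - s|.
Proof. by apply: le_trans (norm_rposB_le _ _) _; rewrite -opprD normrN. Qed.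

(** The map r |-> p r^+ - q r^- has slope p on the right and q on the left of
    0, so it is Lipschitz with the larger of |p| and |q|. *)
Lemma norm_slopesB_le K p q r s : `|p| <= K -> `|q| <= K ->
  `|(p * rpos r - q * rneg r) - (p * rpos s - q * rneg s)| <= K * `|r - s|.
Proof.
move=> pK qK.
wlog sr : r s / s <= r => [th|].
  by have [/th//|/ltW/th] := leP s r; rewrite distrC (distrC s).
have dp : 0 <= rpos r - rpos s by rewrite subr_ge0 ge_max le_max sr rpos_ge0.
have dn : 0 <= rneg s - rneg r.
  by rewrite subr_ge0 ge_max le_max lerN2 sr rneg_ge0.
have rsE : r - s = (rpos r - rpos s) + (rneg s - rneg r).
  by rewrite -{1}(rposBrneg r) -{1}(rposBrneg s); ring.
have -> : (p * rpos r - q * rneg r) - (p * rpos s - q * rneg s) =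
  p * (rpos r - rpos s) + q * (rneg s - rneg r) by ring.
rewrite rsE (ger0_norm (addr_ge0 dp dn)) [leRHS]mulrDr.
apply: le_trans (ler_normD _ _) _; rewrite !normrM (ger0_norm dp) (ger0_norm dn).
by rewrite lerD ?ler_wpM2r.
Qed.

Lemma kdist_kscale_le a x y :
  kdist (kscale a x) (kscale a y) <= kabs a * kdist x y.
Proof.
have K0 : 0 <= kabs a by rewrite le_max normr_ge0.
have lK : `|klo a| <= kabs a by rewrite le_max lexx.
have hK : `|khi a| <= kabs a by rewrite le_max lexx orbT.
rewrite ge_max; apply/andP; split.
  apply: le_trans (norm_slopesB_le _ _ lK hK) _.
  by rewrite ler_wpM2l// le_max lexx.
apply: le_trans (norm_slopesB_le _ _ hK lK) _.
by rewrite ler_wpM2l// le_max lexx orbT.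
Qed.

(** When both endpoints of a have the same sign, each endpoint of a x is a
    two-slope function of one endpoint of x. When they have opposite signs,
    each endpoint of a x is up to sign a maximum of two such functions, one for
    each endpoint of x, and a maximum is Lipschitz for the maximum of the
    differences. *)
Lemma kdist_kmul_le a x y : kdist (kmul a x) (kmul a y) <= kabs a * kdist x y.
Proof.
have K0 : 0 <= kabs a by rewrite le_max normr_ge0.
have lK : `|klo a| <= kabs a by rewrite le_max lexx.
have hK : `|khi a| <= kabs a by rewrite le_max lexx orbT.
have d1 : `|klo x - klo y| <= kdist x y by rewrite le_max lexx.
have d2 : `|khi x - khi y| <= kdist x y by rewrite le_max lexx orbT.
have posL p r s : `|p| <= kabs a -> `|r - s| <= kdist x y ->
    `|p * rpos r - p * rpos s| <= kabs a * kdist x y.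
  move=> pK rs; rewrite -mulrBr normrM; apply: ler_pM => //.
  exact: le_trans (norm_rposB_le _ _) rs.
have negL p r s : `|p| <= kabs a -> `|r - s| <= kdist x y ->
    `|p * rneg r - p * rneg s| <= kabs a * kdist x y.
  move=> pK rs; rewrite -mulrBr normrM; apply: ler_pM => //.
  exact: le_trans (norm_rnegB_le _ _) rs.
have [l0|/ltW l0] := leP 0 (klo a); have [h0|/ltW h0] := leP 0 (khi a).
- by rewrite !kmul_ge0//; exact: kdist_kscale_le.
- rewrite /kmul (rpos_id l0) (rneg_eq0 l0) (rpos_eq0 h0) (rneg_id h0).
  rewrite /kdist /= !mul0r !maxxx !sub0r !subr0 -!opprD !normrN ge_max.
  apply/andP; split; apply: norm_maxB_le.
  + exact: posL.
  + by apply: negL; rewrite ?normrN.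
  + exact: negL.
  + by apply: posL; rewrite ?normrN.
- rewrite /kmul (rpos_id h0) (rneg_eq0 h0) (rpos_eq0 l0) (rneg_id l0).
  rewrite /kdist /= !mul0r !maxxx !sub0r !subr0 -!opprD !normrN ge_max.
  apply/andP; split; apply: norm_maxB_le.
  + exact: negL.
  + by apply: posL; rewrite ?normrN.
  + exact: posL.
  + by apply: negL; rewrite ?normrN.
- by rewrite !kmul_le0// -(kdist_dual x); exact: kdist_kscale_le.
Qed.

Lemma kmul_point0 x : kmul (kpoint 0) x = kpoint 0.
Proof. by rewrite kmul_point rpos_eq0// rneg_eq0// !mul0r subr0. Qed.

Lemma ksubK r a : kadd (kpoint r) (ksub a (kpoint r)) = a.
Proof. by case: a => l h; congr MkKR => /=; rewrite addrC subrK. Qed.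

(** Unless r = 0, both a and the remainder a - r lie on the same side of 0 as r,
    so one linear formula gives all three products. *)
Lemma kmul_splitI a r x :
  Num.min 0 (kfloor a) <= r <= Num.max 0 (kfloor a) ->
  kmul a x = kadd (kmul (kpoint r) x) (kmul (ksub a (kpoint r)) x).
Proof.
move=> rP; have kadd0x y : kadd (kpoint 0) y = y by exact: kadd0.
have zero_case : r = 0 ->
    kmul a x = kadd (kmul (kpoint r) x) (kmul (ksub a (kpoint r)) x).
  move=> ->; rewrite kmul_point0 kadd0x.
  by rewrite /ksub /= !subr0; case: (a).
move: rP; rewrite /kfloor; case: ifP => [/andP[l0 h0]|_].
  have f0 : Num.max (klo a) (khi a) < 0 by rewrite gt_max l0.
  rewrite (max_idPl (ltW f0)) (min_idPr (ltW f0)) ge_max => /andP[/andP[? ?] ?].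
  rewrite !kmul_le0 -?kscaleD ?ksubK//=; lra.
case: ifP => [/andP[l0 h0]|_].
  have f0 : 0 < Num.min (klo a) (khi a) by rewrite lt_min l0.
  rewrite (max_idPr (ltW f0)) (min_idPl (ltW f0)) le_min => /andP[? /andP[? ?]].
  rewrite !kmul_ge0 -?kscaleD ?ksubK//=; lra.
by rewrite minxx maxxx => r0; apply: zero_case; apply/eqP; rewrite eq_le andbC.
Qed.

(** Unless r = 0, the remainder a - r lies on the other side of 0 than a and r;
    its product with the dual of x is given by the same linear formula as their products
    with x. *)
Lemma kmul_splitII a x :
  let r := kceil a in
  kmul a x = kadd (kmul (kpoint r) x)
    (kmul (ksub a (kpoint r)) (if r == 0 then x else kdual x)).
Proof.
rewrite /= /kceil; case: ifP => [/andP[l0 h0]|_].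
  have f0 : Num.min (klo a) (khi a) < 0 by rewrite gt_min l0.
  have fl : Num.min (klo a) (khi a) <= klo a by rewrite ge_min lexx.
  have fh : Num.min (klo a) (khi a) <= khi a by rewrite ge_min lexx orbT.
  rewrite lt_eqF// (kmul_le0 (a := a)) ?(kmul_le0 (a := kpoint _)) ?(ltW f0) ?ltW//.
  by rewrite kmul_ge0 ?subr_ge0// -kscaleD ksubK.
case: ifP => [/andP[l0 h0]|_].
  have f0 : 0 < Num.max (klo a) (khi a) by rewrite lt_max l0.
  have fl : klo a <= Num.max (klo a) (khi a) by rewrite le_max lexx.
  have fh : khi a <= Num.max (klo a) (khi a) by rewrite le_max lexx orbT.
  rewrite gt_eqF// (kmul_ge0 (a := a)) ?(kmul_ge0 (a := kpoint _)) ?(ltW f0) ?ltW//.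
  by rewrite kmul_le0 ?subr_le0// -kscaleD ksubK.
rewrite eqxx kmul_point0 [RHS](kadd0 _).
by rewrite /ksub /= !subr0; case: a.
Qed.

End KaucherScalar.

(** * Immersed interval vectors *)

Section Immersion.
Variables (R : realType).

Lemma klo_ksum (I : finType) (F : I -> KR R) : klo (ksum F) = \sum_i klo (F i).
Proof. exact: (big_morph (@klo R) (fun _ _ => erefl) erefl). Qed.

Lemma khi_ksum (I : finType) (F : I -> KR R) : khi (ksum F) = \sum_i khi (F i).
Proof. exact: (big_morph (@khi R) (fun _ _ => erefl) erefl). Qed.

Lemma kdist_ksum_le (I : finType) (F E : I -> KR R) :
  kdist (ksum F) (ksum E) <= \sum_i kdist (F i) (E i).
Proof.
rewrite ge_max !klo_ksum !khi_ksum -!sumrB; apply/andP; split;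
  apply: (le_trans (ler_norm_sum _ _ _)); apply: ler_sum => i _.
  by rewrite le_max lexx.
by rewrite le_max lexx orbT.
Qed.

Lemma ksum_kadd (I : finType) (F E : I -> KR R) :
  ksum (fun i => kadd (F i) (E i)) = kadd (ksum F) (ksum E).
Proof. by rewrite /ksum big_split. Qed.

Lemma norm_mulmx_le m p (M : 'M[R]_(m, p)) (d e : 'cV[R]_p) i :
  (forall j, `|d j 0| <= e j 0) -> `|(M *m d) i 0| <= (absmx M *m e) i 0.
Proof.
move=> de; rewrite !mxE; apply: (le_trans (ler_norm_sum _ _ _)).
by apply: ler_sum => j _; rewrite normrM mxE ler_wpM2l.
Qed.

Variable n : nat.
Implicit Types (A H : 'M[KR R]_n) (G Q : 'M[R]_n) (x y c : 'cV[KR R]_n).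

Lemma kdist_kominus (a p r : KR R) : kdist (kominus a p) (kominus a r) = kdist p r.
Proof.
have E (s t v : R) : `|(s - t) - (s - v)| = `|t - v|.
  by rewrite (_ : _ - _ = v - t); [exact: distrC|ring].
by rewrite /kdist /= !E.
Qed.

Lemma norm_stiB_le x y (e : 'cV[R]_n) k :
    (forall i, kdist (x i 0) (y i 0) <= e i 0) ->
  `|sti x k 0 - sti y k 0| <= col_mx e e k 0.
Proof.
move=> xye; rewrite -(splitK k) /sti; case: (fintype.split k) => i /=;
  have := xye i; rewrite ge_max => /andP[dl dh].
  by rewrite !col_mxEu !mxE -opprD normrN.
by rewrite !col_mxEd !mxE.
Qed.

Lemma extmul_sti G x :
  extmul G *m sti x = sti (kmulmx (map_mx (@kpoint R) G) x).
Proof.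
rewrite /extmul /sti mul_block_col; congr col_mx; apply/colP => i.
  rewrite !mxE klo_ksum -sumrN -big_split; apply: eq_bigr => j _.
  by rewrite !mxE kmul_point /=; ring.
rewrite !mxE khi_ksum -big_split; apply: eq_bigr => j _.
by rewrite !mxE kmul_point /=; ring.
Qed.

Lemma extmul_nonneg Q : (forall i j, 0 <= Q i j) -> extmul Q = block_mx Q 0 0 Q.
Proof.
move=> Q0; congr block_mx; apply/matrixP => i j; rewrite !mxE;
  by rewrite ?rpos_id ?rneg_eq0.
Qed.

(** G~ commutes with the exchange of the two halves of R^2n, hence so does its
    inverse. *)
Lemma invmx_extmul_block G : extmul G \in unitmx ->
  exists P Q, invmx (extmul G) = block_mx P Q Q P.
Proof.
move=> Gu; pose J : 'M[R]_(n + n) := block_mx 0 1%:M 1%:M 0.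
have JG : J *m extmul G = extmul G *m J.
  by rewrite !mulmx_block !mul0mx !mul1mx !mulmx0 !mulmx1 !add0r !addr0.
have JV : J *m invmx (extmul G) = invmx (extmul G) *m J.
  by rewrite -[LHS]mul1mx -{1}(mulVmx Gu) -!mulmxA (mulmxA (extmul G)) -JG
    -!mulmxA mulmxV// mulmx1.
set V := invmx (extmul G) in JV *; exists (ulsubmx V), (ursubmx V).
move: JV; rewrite -{1 2}[V]submxK !mulmx_block.
rewrite !mul0mx !mul1mx !mulmx0 !mulmx1 !add0r !addr0 => /eq_block_mx[dl dr _ _].
by rewrite -[LHS]submxK dl dr.
Qed.

Variables (G : 'M[R]_n) (H : 'M[KR R]_n).
Hypothesis Gu : extmul G \in unitmx.
Let V := invmx (extmul G).

(** If u = (v1, v2) satisfies |V| |H|~ u < u, so does (v2, v1) by symmetry, and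
    so does their sum (w, w) with w = v1 + v2. As |H| >= 0, the product
    |H|~ (w, w) is (|H| w, |H| w). *)
Lemma symmetric_weight : spectral_radius (absmx V *m extmul (kabsmx H)) < 1 ->
  exists2 w : 'cV[R]_n, (forall i, 0 < w i 0) &
    forall i, (absmx V *m col_mx (kabsmx H *m w) (kabsmx H *m w)) i 0
               < (col_mx w w) i 0.
Proof.
have H0 i j : 0 <= kabsmx H i j by rewrite mxE le_max normr_ge0.
have M0 i j : 0 <= (absmx V *m extmul (kabsmx H)) i j.
  rewrite mxE; apply: sumr_ge0 => k _; apply: mulr_ge0.
    by rewrite mxE.
  rewrite extmul_nonneg// /block_mx.
  rewrite -(splitK k) -(splitK j).
  by case: (fintype.split k) => k'; case: (fintype.split j) => j' /=;
    rewrite ?block_mxEul ?block_mxEur ?block_mxEdl ?block_mxEdr // mxE.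
move=> /(spectral_radius_lt1_weight M0)[u u0].
have [P [Q VE]] := invmx_extmul_block Gu.
have aV : absmx V = block_mx (absmx P) (absmx Q) (absmx Q) (absmx P).
  by rewrite /V VE /absmx map_block_mx.
rewrite aV extmul_nonneg// -[u]vsubmxK mulmx_block !mulmx0 !addr0 !add0r.
rewrite mul_block_col => Mu; set v1 := usubmx u in Mu; set v2 := dsubmx u in Mu.
pose Hw := kabsmx H *m (v1 + v2).
have Mw i : (absmx P *m Hw + absmx Q *m Hw) i 0 < (v1 + v2) i 0.
  have := ltrD (Mu (lshift n i)) (Mu (rshift n i)).
  have colD (d e : 'cV[R]_n) : (d + e) i 0 = d i 0 + e i 0 by rewrite mxE.
  rewrite !col_mxEu !col_mxEd -!mulmxA /Hw !mulmxDr !colD; congr (_ < _).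
  by ring.
exists (v1 + v2) => i.
  by have := addr_gt0 (u0 (lshift n i)) (u0 (rshift n i)); rewrite !mxE.
rewrite mul_block_col -(splitK i); case: (fintype.split i) => j /=.
  by rewrite !col_mxEu.
by rewrite !col_mxEd addrC.
Qed.

Let step (Phi : 'cV[KR R]_n -> 'cV[KR R]_n) c (y : 'cV[R]_(n + n)) :=
  V *m sti (kvominus c (Phi (sti_inv y))).

(** The common core of the two iterations: the Lipschitz bound makes the step a
    contraction for the weight (w, w), and the splitting of A identifies its
    fixed points with the formal solutions. *)
Lemma split_iteration A b (Phi : 'cV[KR R]_n -> 'cV[KR R]_n) :
    spectral_radius (absmx V *m extmul (kabsmx H)) < 1 ->
    (forall x y i, kdist (Phi x i 0) (Phi y i 0)
       <= \sum_j kabs (H i j) * kdist (x j 0) (y j 0)) ->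
    (forall x i, kmulmx A x i 0
       = kadd (kmulmx (map_mx (@kpoint R) G) x i 0) (Phi x i 0)) ->
  exists2 xs, unique (formal_solution A b) xs &
    forall x : nat -> 'cV[R]_(n + n),
      (forall k, x k.+1 = step Phi b (x k)) -> x @ \oo --> sti xs.
Proof.
move=> rho PhiL Asplit.
have [w w0 Vw] := symmetric_weight rho.
pose u : 'cV[R]_(n + n) := col_mx w w.
have ul i : u (lshift n i) 0 = w i 0 by rewrite col_mxEu.
have ur i : u (rshift n i) 0 = w i 0 by rewrite col_mxEd.
have u0 i : 0 < u i 0.
  by rewrite -(splitK i); case: (fintype.split i) => j /=; rewrite ?ul ?ur.
pose Hw := kabsmx H *m w.
pose VHw := absmx V *m col_mx Hw Hw.
(* The contraction factor: the smallest q >= 0 with |V| |H|~ u <= q u. *)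
pose q := \big[Num.max/0]_i (VHw i 0 / u i 0).
have q_ge i : VHw i 0 <= q * u i 0.
  rewrite -ler_pdivrMr//.
  exact: (@le_bigmax _ _ _ 0 (fun i => VHw i 0 / u i 0)).
have q01 : 0 <= q < 1.
  rewrite bigmax_ge_id /=; apply/bigmax_ltP; split=> // i _.
  by rewrite ltr_pdivrMr// mul1r; exact: Vw.
have stepL (y z : 'cV[R]_(n + n)) t : (forall i, `|y i 0 - z i 0| <= t * u i 0) ->
    forall i, `|step Phi b y i 0 - step Phi b z i 0| <= q * t * u i 0.
  move=> yz i.
  have t0 : 0 <= t by have := le_trans (normr_ge0 _) (yz i); rewrite pmulr_lge0.
  have dist_yz j : kdist (sti_inv y j 0) (sti_inv z j 0) <= t * w j 0.
    rewrite ge_max; apply/andP; split.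
      by rewrite !mxE /= -opprD normrN -(ul j); exact: yz.
    by rewrite !mxE /= -(ur j); exact: yz.
  have dist_Phi j : kdist (Phi (sti_inv y) j 0) (Phi (sti_inv z) j 0) <= t * Hw j 0.
    apply: (le_trans (PhiL _ _ _)); rewrite mxE mulr_sumr; apply: ler_sum => k _.
    by rewrite [kabsmx _ _ _]mxE mulrCA ler_wpM2l// le_max normr_ge0.
  have colB m (d e : 'cV[R]_m) k : (d - e) k 0 = d k 0 - e k 0 by rewrite !mxE.
  rewrite -colB /step -mulmxBr.
  apply: (@le_trans _ _ ((absmx V *m (t *: col_mx Hw Hw)) i 0)).
    apply: norm_mulmx_le => k; rewrite colB scale_col_mx.
    apply: norm_stiB_le => j; rewrite [leRHS]mxE.
    have dE x : kvominus b x j 0 = kominus (b j 0) (x j 0) by rewrite mxE.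
    by rewrite !dE kdist_kominus.
  by rewrite -scalemxAr mxE -/VHw (mulrC q) -mulrA ler_wpM2l.
have GPhiE x : kvominus b (Phi x) = kmulmx (map_mx (@kpoint R) G) x <->
    formal_solution A b x.
  split=> [Gx|Ax]; apply/colP => i.
    by rewrite Asplit -Gx mxE /kadd /= !subrK; case: (b i 0).
  rewrite mxE -Ax Asplit; case: (kmulmx _ _ _ _) => gl gh.
  by congr MkKR; rewrite /= addrK.
have fixedE x : step Phi b (sti x) = sti x <-> formal_solution A b x.
  rewrite -GPhiE /step stiK; split=> [fx|->].
    by apply: (can_inj (@stiK R n)); rewrite -extmul_sti -fx mulKVmx.
  by rewrite -extmul_sti mulKmx.
have [p [pE p_uniq p_cvg]] := weighted_contraction_fixed_point u0 q01 stepL.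
exists (sti_inv p); last by rewrite sti_invK.
split; first by apply/fixedE; rewrite sti_invK.
by move=> x /fixedE/p_uniq <-; rewrite stiK.
Qed.

End Immersion.

(** * The two splittings *)

Lemma kop_lipschitz (R : realType) n (H : 'M[KR R]_n) (G : 'M[R]_n) x y i :
  kdist (kop G H x i 0) (kop G H y i 0)
    <= \sum_j kabs (H i j) * kdist (x j 0) (y j 0).
Proof.
rewrite !mxE; apply: (le_trans (kdist_ksum_le _ _)); apply: ler_sum => j _.
by apply: (le_trans (kdist_kmul_le _ _ _)); case: ifP; rewrite ?kdist_dual.
Qed.

Lemma kmulmx_lipschitz (R : realType) n (H : 'M[KR R]_n) x y i :
  kdist (kmulmx H x i 0) (kmulmx H y i 0)
    <= \sum_j kabs (H i j) * kdist (x j 0) (y j 0).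
Proof.
rewrite !mxE; apply: (le_trans (kdist_ksum_le _ _)); apply: ler_sum => j _.
exact: kdist_kmul_le.
Qed.

Lemma kmulmx_splitI (R : realType) n (A H : 'M[KR R]_n) (G : 'M[R]_n) x i :
  splittingI A G H -> kmulmx A x i 0 =
    kadd (kmulmx (map_mx (@kpoint R) G) x i 0) (kmulmx H x i 0).
Proof.
move=> [GP ->]; rewrite !mxE -ksum_kadd; apply: eq_bigr => j _.
by rewrite !mxE; exact: kmul_splitI.
Qed.

Lemma kmulmx_splitII (R : realType) n (A H : 'M[KR R]_n) (G : 'M[R]_n) x i :
  splittingII A G H -> kmulmx A x i 0 =
    kadd (kmulmx (map_mx (@kpoint R) G) x i 0) (kop G H x i 0).
Proof.
move=> [-> ->]; rewrite !mxE -ksum_kadd; apply: eq_bigr => j _.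
by rewrite !mxE; exact: kmul_splitII.
Qed.

Theorem theorem3 (R : realType) (n : nat)
    (A : 'M[KR R]_n) (b : 'cV[KR R]_n) (G : 'M[R]_n) (H : 'M[KR R]_n)
    (hsplit : splittingI A G H \/ splittingII A G H)
    (hG : extmul G \in unitmx)
    (hrho : spectral_radius
              (absmx (invmx (extmul G)) *m extmul (kabsmx H)) < 1) :
  exists xs : 'cV[KR R]_n,
    unique (formal_solution A b) xs /\
    (splittingI A G H ->
     forall x : nat -> 'cV[R]_(n + n),
       (forall k, x k.+1 = stepI G H b (x k)) -> x @ \oo --> sti xs) /\
    (splittingII A G H ->
     forall x : nat -> 'cV[R]_(n + n),
       (forall k, x k.+1 = stepII G H b (x k)) -> x @ \oo --> sti xs).
Proof.
have solI : splittingI A G H -> exists2 xs, unique (formal_solution A b) xs &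
    forall x : nat -> 'cV[R]_(n + n),
      (forall k, x k.+1 = stepI G H b (x k)) -> x @ \oo --> sti xs.
  move=> sI; apply: (split_iteration hG b hrho (@kmulmx_lipschitz R n H)).
  by move=> x i; exact: kmulmx_splitI.
have solII : splittingII A G H -> exists2 xs, unique (formal_solution A b) xs &
    forall x : nat -> 'cV[R]_(n + n),
      (forall k, x k.+1 = stepII G H b (x k)) -> x @ \oo --> sti xs.
  move=> sII; apply: (split_iteration hG b hrho (@kop_lipschitz R n H G)).
  by move=> x i; exact: kmulmx_splitII.
(* A pair (G, H) may be a splitting of both kinds: uniqueness identifies the
   limits of the two iterations. *)
have [xs xsP] : exists xs, unique (formal_solution A b) xs.
  by case: hsplit => [/solI|/solII] [xs ? _]; exists xs.
exists xs; split => //; split=> [/solI|/solII] [x' [x'P _] x'cvg].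
  by rewrite (xsP.2 _ x'P).
by rewrite (xsP.2 _ x'P).
Qed.
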